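(* For all integers $n\geq 1$, the degenerate Genocchi polynomials are expressed through the degenerate Bernoulli polynomials by $$\mathcal{G}_{n;q}(x)=-2\,\frac{c_{n;q}}{c_{n+1;q}}\sum_{k=0}^{n-1}\binom{n+1}{k}_{c;q}\mathcal{G}_{n-k+1;q}\,\mathcal{B}_{k;q}(x),$$ and also by $$\mathcal{G}_{n;q}(x)=\frac{c_{n;q}}{c_{n+1;q}}\sum_{k=0}^n\sum_{m=0}^{n-k}\binom{n+1}{k,m,n+1-k-m}_{c;q}\mathcal{G}_{m;q}\,\mathcal{B}_{k;q}(x).$$
   Context: Fix a complex parameter $q\neq 1$ such that $jq-(j-1)\neq 0$ for all integers $j\ge 1$. Let $Q_0(q)=1$, $Q_n(q)=\prod_{j=1}^{n}(jq-(j-1))$, and $c_{0;q}=1$, $c_{n;q}=n!/Q_{n-1}(q)$ for $n\ge 1$. The Carlitz-Tsallis deformed exponential is $e_q(x)=(1+(1-q)x)^{1/(1-q)}=\sum_{n\ge 0}x^n/c_{n;q}$ (as a formal power series). Put $\binom{n}{k}_{c;q}=\frac{c_{n;q}}{c_{k;q}c_{n-k;q}}$ for $0\le k\le n$, and $\binom{n+1}{k,m,n+1-k-m}_{c;q}=\frac{c_{n+1;q}}{c_{k;q}\,c_{m;q}\,c_{n+1-k-m;q}}$. The degenerate Bernoulli polynomials $\mathcal{B}_{n;q}(x)$ and degenerate Genocchi polynomials $\mathcal{G}_{n;q}(x)$ are defined by the formal power series identities in $t$ $$\frac{t}{e_q(t)-1}e_q(xt)=\sum_{n\ge0}\mathcal{B}_{n;q}(x)\frac{t^n}{c_{n;q}},\qquad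 \frac{2t}{e_q(t)+1}e_q(xt)=\sum_{n\ge0}\mathcal{G}_{n;q}(x)\frac{t^n}{c_{n;q}},$$ and the degenerate Genocchi numbers are $\mathcal{G}_{n;q}=\mathcal{G}_{n;q}(0)$. *)

(* Defs.v *)
From HB Require Import structures.
From mathcomp Require Import all_boot all_algebra.
From mathcomp Require Export complex.
From mathcomp Require Import ring zify.
From mathcomp Require Import boolp classical_sets.
From mathcomp Require Export reals.

Set Implicit Arguments.
Unset Strict Implicit.
Unset Printing Implicit Defensive.

Import GRing.Theory Num.Theory.
Local Open Scope ring_scope.

(** Formal power series in one variable [t]: [Fps f] is [\sum_n f n * t^n]. *)
Record fps (A : Type) := Fps { fps_coef : nat -> A }.

Lemma fpsP (A : Type) (f g : fps A) :
  fps_coef f =1 fps_coef g -> f = g.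
Proof. by case: f g => [f] [g] /= /funext ->. Qed.

HB.instance Definition _ (A : Type) := gen_eqMixin (fps A).
HB.instance Definition _ (A : Type) := gen_choiceMixin (fps A).

Section FpsRing.
Variable A : comNzRingType.
Implicit Types f g h : fps A.

Definition fps_add f g := Fps (fun n => fps_coef f n + fps_coef g n).
Definition fps_opp f := Fps (fun n => - fps_coef f n).
Definition fps_zero : fps A := Fps (fun=> 0).
Definition fps_one : fps A := Fps (fun n => (n == 0)%:R).
Definition fps_mul f g :=
  Fps (fun n => \sum_(i < n.+1) fps_coef f i * fps_coef g (n - i)).

Lemma fps_addA : associative fps_add.
Proof. by move=> f g h; apply: fpsP => n /=; rewrite addrA. Qed.
Lemma fps_addC : commutative fps_add.
Proof. by move=> f g; apply: fpsP => n /=; rewrite addrC. Qed.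
Lemma fps_add0 : left_id fps_zero fps_add.
Proof. by move=> f; apply: fpsP => n /=; rewrite add0r. Qed.
Lemma fps_addN : left_inverse fps_zero fps_opp fps_add.
Proof. by move=> f; apply: fpsP => n /=; rewrite addNr. Qed.

HB.instance Definition _ :=
  GRing.isZmodule.Build (fps A) fps_addA fps_addC fps_add0 fps_addN.

Let trunc (N : nat) f : {poly A} := \poly_(i < N.+1) fps_coef f i.

Let coef_mul_trunc f g N (p r : {poly A}) :
  (forall i, (i <= N)%N -> p`_i = fps_coef f i) ->
  (forall i, (i <= N)%N -> r`_i = fps_coef g i) ->
  forall n, (n <= N)%N -> (p * r)`_n = fps_coef (fps_mul f g) n.
Proof.
move=> hp hr n hn; rewrite coefM /=; apply: eq_bigr => i _.
rewrite hp ?hr //; last by apply: leq_trans hn; rewrite -ltnS.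
by apply: leq_trans hn; apply: leq_subr.
Qed.

Let coef_trunc N f i : (i <= N)%N -> (trunc N f)`_i = fps_coef f i.
Proof. by move=> hi; rewrite coef_poly ltnS hi. Qed.

Lemma fps_mulA : associative fps_mul.
Proof.
move=> f g h; apply: fpsP => n.
have cT := @coef_trunc n.
rewrite -(coef_mul_trunc (cT f) (coef_mul_trunc (cT g) (cT h)) (leqnn n)).
by rewrite mulrA (coef_mul_trunc (coef_mul_trunc (cT f) (cT g)) (cT h)).
Qed.

Lemma fps_mulC : commutative fps_mul.
Proof.
move=> f g; apply: fpsP => n; have cT := @coef_trunc n.
by rewrite -(coef_mul_trunc (cT f) (cT g) (leqnn n)) mulrC (coef_mul_trunc (cT g) (cT f)).
Qed.

Lemma fps_mul1 : left_id fps_one fps_mul.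
Proof.
move=> f; apply: fpsP => n /=.
rewrite big_ord_recl /= mul1r subn0 big1 ?addr0 // => i _.
by rewrite mul0r.
Qed.

Lemma fps_mulDl : left_distributive fps_mul fps_add.
Proof.
move=> f g h; apply: fpsP => n /=; rewrite -big_split /=.
by apply: eq_bigr => i _; rewrite mulrDl.
Qed.

Lemma fps_one_neq0 : fps_one != fps_zero.
Proof.
apply/eqP => /(congr1 (fun f => fps_coef f 0)) /= /eqP.
by rewrite oner_eq0.
Qed.

HB.instance Definition _ :=
  GRing.Zmodule_isComNzRing.Build (fps A)
    fps_mulA fps_mulC fps_mul1 fps_mulDl fps_one_neq0.

Definition fps_t : fps A := Fps (fun n => (n == 1)%:R).

(** The series [h] with [h * g = f], as is meant by [t / (e_q(t) - 1)], whose
    denominator is not invertible; [0] if there is no such [h]. *)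
Definition fps_div f g : fps A := xget 0 [set h | h * g = f]%classic.

Lemma fps_coefD f g n : fps_coef (f + g) n = fps_coef f n + fps_coef g n.
Proof. by []. Qed.
Lemma fps_coefB f g n : fps_coef (f - g) n = fps_coef f n - fps_coef g n.
Proof. by []. Qed.
Lemma fps_coefM f g n :
  fps_coef (f * g) n = \sum_(i < n.+1) fps_coef f i * fps_coef g (n - i).
Proof. by []. Qed.
Lemma fps_coef1 n : fps_coef (1 : fps A) n = (n == 0)%:R.
Proof. by []. Qed.

Lemma fps_coeftM f n :
  fps_coef (fps_t * f) n = if n is m.+1 then fps_coef f m else 0.
Proof.
rewrite fps_coefM; case: n => [|n]; first by rewrite big_ord1 mul0r.
rewrite big_ord_recl mul0r add0r big_ord_recl /= mul1r subSS subn0.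
by rewrite big1 ?addr0 // => i _; rewrite mul0r.
Qed.

End FpsRing.

Lemma fps_mulf_eq0 (A : idomainType) (h g : fps A) :
  g != 0 -> h * g = 0 -> h = 0.
Proof.
move=> gN0 hg0.
have exv : exists v, fps_coef g v != 0.
  apply: contrapT => /forallNP ng; case/eqP: gN0; apply: fpsP => n.
  by apply/eqP; rewrite -[_ == _]negbK; apply/negP/ng.
case: (ex_minnP exv) => v gv vmin.
apply: fpsP => n; elim/ltn_ind: n => n IH.
have /(congr1 (fun f => fps_coef f (n + v))) := hg0.
rewrite fps_coefM.
have nv : (n < (n + v).+1)%N by rewrite ltnS leq_addr.
rewrite (bigD1 (Ordinal nv)) //= addKn big1 ?addr0.
  by move/eqP; rewrite mulf_eq0 (negbTE gv) orbF => /eqP.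
move=> i; rewrite -val_eqE /= => iNn; case: (ltngtP i n) => [lt_in|lt_ni|eq_in].
- by rewrite IH //= mul0r.
- have /eqP -> : fps_coef g (n + v - i) == 0; last by rewrite mulr0.
  apply: contraT => /vmin; rewrite leqNgt => /negP[].
  by have := ltn_ord i; lia.
- by rewrite eq_in eqxx in iNn.
Qed.

Lemma fps_div_unique (A : idomainType) (f g h : fps A) :
  g != 0 -> h * g = f -> fps_div f g = h.
Proof.
move=> gN0 hgf; apply: xget_unique => // h' /= h'gf.
apply/eqP; rewrite -subr_eq0; apply/eqP/(fps_mulf_eq0 gN0).
by rewrite mulrBl hgf h'gf subrr.
Qed.

Lemma fps_divK (A : comNzRingType) (f g : fps A) :
  (exists h, h * g = f) -> fps_div f g * g = f.
Proof. exact: xgetPex. Qed.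

Lemma fps_inv_exists (A : comUnitRingType) (u : fps A) :
  fps_coef u 0 \is a GRing.unit -> exists h, h * u = 1.
Proof.
move=> u0.
pose next (s : seq A) := - (\sum_(i < size s) s`_i * fps_coef u (size s - i))
  / fps_coef u 0.
pose L n : seq A := iter n (fun s => rcons s (next s)) [:: (fps_coef u 0)^-1].
have szL n : size (L n) = n.+1 by elim: n => //= n; rewrite size_rcons => ->.
have LL m n : (n <= m)%N -> (L m)`_n = (L n)`_n.
  elim: m => [|m IH]; first by case: n.
  rewrite leq_eqVlt => /orP[/eqP -> //|]; rewrite ltnS => nm.
  by rewrite -IH //= nth_rcons szL ltnS nm.
exists (Fps (fun n => (L n)`_n)); apply: fpsP => -[|n].
  by rewrite fps_coefM big_ord1 /= mulVr.
rewrite fps_coefM big_ord_recr /= subnn nth_rcons szL ltnn eqxx /next szL.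
rewrite mulrVK //=; apply/eqP; rewrite subr_eq0; apply/eqP.
by apply: eq_bigr => i _; rewrite (LL n i) // -ltnS.
Qed.

Section Degenerate.
Variable K : numFieldType.
Implicit Types (q : K) (n k m : nat).

Definition Qq q n : K := \prod_(1 <= j < n.+1) (j%:R * q - (j%:R - 1)).

Definition cq q n : K := if n is m.+1 then n`!%:R / Qq q m else 1.

Definition binomc q n k : K := cq q n / (cq q k * cq q (n - k)).

Definition trinomc q n k m : K :=
  cq q n / (cq q k * cq q m * cq q (n - k - m)).

Definition gbinom (a : K) n : K := (\prod_(i < n) (a - i%:R)) / n`!%:R.

(** The binomial series [(1 + u t)^a]. *)
Definition binom_series (a : K) (u : {poly K}) : fps {poly K} :=
  Fps (fun n => gbinom a n *: u ^+ n).

(** [e_q(u t) = (1 + (1 - q) u t)^(1 / (1 - q))].  The coefficient ring is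
    [{poly K}], so that [u] may be [1] or the polynomial variable ['X]. *)
Definition eq_series q (u : {poly K}) : fps {poly K} :=
  binom_series (1 - q)^-1 ((1 - q) *: u).

Definition bernoulli_series q : fps {poly K} :=
  fps_div (fps_t _) (eq_series q 1 - 1) * eq_series q 'X.

Definition genocchi_series q : fps {poly K} :=
  fps_div (2 * fps_t _) (eq_series q 1 + 1) * eq_series q 'X.

Definition bernoulli q n : {poly K} :=
  cq q n *: fps_coef (bernoulli_series q) n.

Definition genocchi q n : {poly K} :=
  cq q n *: fps_coef (genocchi_series q) n.

Definition genocchi_number q n : K := (genocchi q n).[0].

Section Theory.
Variable q : K.
Hypothesis q_neq1 : q != 1.
Hypothesis q_gen : forall j, (1 <= j)%N -> j%:R * q - (j%:R - 1) != 0.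

Lemma Qq_neq0 n : Qq q n != 0.
Proof.
rewrite /Qq big_nat_cond prodf_seq_neq0; apply/allP => j _.
by apply/implyP => /andP[/andP[j1 _] _]; apply: q_gen.
Qed.

Lemma cq_neq0 n : cq q n != 0.
Proof.
case: n => [|n]; first exact: oner_neq0.
by rewrite mulf_neq0 ?invr_neq0 ?Qq_neq0 // pnatr_eq0 -lt0n fact_gt0.
Qed.

Lemma eq_seriesE (u : {poly K}) :
  eq_series q u = Fps (fun n => (cq q n)^-1 *: u ^+ n).
Proof.
apply: fpsP => n /=; rewrite exprZn scalerA; congr (_ *: _).
have p0 : 1 - q != 0 by rewrite subr_eq0 eq_sym.
have -> : (1 - q) ^+ n = \prod_(i < n) (1 - q) by rewrite prodr_const card_ord.
rewrite /gbinom mulrC mulrA -big_split /=.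
case: n => [|n]; first by rewrite big_ord0 fact0 divr1 invr1.
rewrite /= invfM invrK mulrC; congr (_ * _).
rewrite big_ord_recl /= subr0 mulfV // mul1r /Qq big_add1 /= big_mkord.
apply: eq_bigr => i _; rewrite /bump /= add1n mulrBr mulfV //.
by ring.
Qed.

Lemma bernoulli_divK :
  fps_div (fps_t _) (eq_series q 1 - 1) * (eq_series q 1 - 1) = fps_t _.
Proof.
apply: fps_divK.
pose w : fps {poly K} := Fps (fun n => ((cq q n.+1)^-1)%:P).
have [|h hw] := @fps_inv_exists _ w.
  rewrite -[fps_coef w 0]/((cq q 1)^-1)%:P poly_unitE size_polyC coefC eqxx.
  by rewrite unitfE invr_eq0 cq_neq0.
exists h; have -> : eq_series q 1 - 1 = fps_t _ * w.
  apply: fpsP => n; rewrite fps_coeftM fps_coefB fps_coef1 eq_seriesE /=.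
  case: n => [|n] /=; first by rewrite expr0 invr1 scale1r subrr.
  by rewrite subr0 expr1n -mul_polyC mulr1.
by rewrite mulrCA hw mulr1.
Qed.

Lemma genocchi_divK :
  fps_div (2 * fps_t _) (eq_series q 1 + 1) * (eq_series q 1 + 1) = 2 * fps_t _.
Proof.
have [h hw] : exists h, h * (eq_series q 1 + 1) = 1.
  apply: fps_inv_exists.
  rewrite fps_coefD fps_coef1 eq_seriesE /= expr0 invr1 scale1r.
  by rewrite -[1 + 1]/(2%:R) -polyC_natr poly_unitE size_polyC coefC /= unitfE pnatr_eq0.
by apply: fps_divK; exists (2 * fps_t _ * h); rewrite -mulrA hw mulr1.
Qed.

Lemma bernoulli_egf :
  bernoulli_series q = Fps (fun n => (cq q n)^-1 *: bernoulli q n).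
Proof.
by apply: fpsP => n /=; rewrite scalerA mulVf ?cq_neq0 // scale1r.
Qed.

Lemma genocchi_egf :
  genocchi_series q = Fps (fun n => (cq q n)^-1 *: genocchi q n).
Proof.
by apply: fpsP => n /=; rewrite scalerA mulVf ?cq_neq0 // scale1r.
Qed.

End Theory.
End Degenerate.

(* Main.v *)
Require Import Defs.
From mathcomp Require Import all_boot all_algebra.
From mathcomp Require Import ring.
Import GRing.Theory Num.Theory.
Local Open Scope ring_scope.

(** Write [E] for [e_q(t)], [X] for [e_q(xt)], [A = t / (E - 1)] and
    [D = 2t / (E + 1)], so that the Bernoulli and Genocchi polynomials are the
    normalized coefficients of [A X] and [D X].  Since [t = A (E - 1)],
      [t (D X) = (D (E - 1)) (A X)],
    and comparing coefficients of [t^(n+1)] writes [G_n(x) / c_n] as the sum of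
    the [B_k(x) / c_k] weighted by the coefficients of [D (E - 1)]
    ([genocchi_convolution]).  Both identities come from computing these
    coefficients.

    As the constant term of [E] is [1], multiplying out [D (E - 1)] leaves the
    terms [D_m / c_(j-m)] with [m < j]: this is the second identity.  On the
    other hand [D (E - 1) = D (E + 1) - 2 D = 2t - 2 D], whose coefficients
    from degree 2 on are [- 2 D_j], while those of degree 0 and 1 vanish because
    neither [D] nor [E - 1] has a constant term: this is the first identity,
    whose sum therefore stops at [k = n - 1].

    The coefficients of [D] are a priori polynomials in [x].  Evaluating them at
    [x = 0] gives another solution of [D (E + 1) = 2t], so they are constants,
    and evaluating [D X] at [x = 0] shows that they are the normalized Genocchi
    numbers ([genocchi_quotient_coef]). *)

Definition fps_map {A B : nzRingType} (f : A -> B) (s : fps A) : fps B :=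
  Fps (fun n => f (fps_coef s n)).

Lemma fps_mapM (A B : comNzRingType) (f : {rmorphism A -> B}) (s r : fps A) :
  fps_map f (s * r) = fps_map f s * fps_map f r.
Proof.
apply: fpsP => n; rewrite fps_coefM /= rmorph_sum.
by apply: eq_bigr => i _; rewrite rmorphM.
Qed.

(** Division by [t] on the left: coefficient [n] of [f] is coefficient [n + 1]
    of [t f], and the last term of that convolution drops out when the other
    factor has no constant term. *)
Lemma fps_coef_convolution (A : comNzRingType) (f g h : fps A) n :
    fps_t A * f = g * h -> fps_coef g 0 = 0 ->
  fps_coef f n = \sum_(k < n.+1) fps_coef g (n - k).+1 * fps_coef h k.
Proof.
move=> tf g0; rewrite -[LHS](fps_coeftM f n.+1) tf mulrC fps_coefM.
rewrite big_ord_recr /= subnn g0 mulr0 addr0; apply: eq_bigr => k _.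
by rewrite mulrC subSn // -ltnS.
Qed.

Section GenocchiBernoulli.
Variables (K : numFieldType) (q : K).
Hypothesis q_neq1 : q != 1.
Hypothesis q_gen : forall j : nat, (1 <= j)%N -> j%:R * q - (j%:R - 1) != 0.

Local Notation E := (eq_series q 1).
Local Notation D := (fps_div (2 * fps_t _) (E + 1)).
Local Notation ev0 := (polyC \o horner_eval (0 : K)).

Lemma eq_series1_coef n : fps_coef E n = ((cq q n)^-1)%:P.
Proof. by rewrite eq_seriesE //= expr1n alg_polyC. Qed.

Lemma genocchi_denominator_coef n :
  fps_coef (E + 1) n = ((cq q n)^-1 + (n == 0)%:R)%:P.
Proof.
by rewrite fps_coefD eq_series1_coef fps_coef1 polyCD polyC_natr.
Qed.

Lemma genocchi_denominator_neq0 : E + 1 != 0.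
Proof.
apply/eqP => den0; have : (fps_coef (E + 1) 0).[0] = 0.
  by rewrite den0 horner0.
rewrite genocchi_denominator_coef hornerC /= invr1 => /eqP.
by rewrite -mulr2n pnatr_eq0.
Qed.

(** The quotient [2t / (e_q(t) + 1)] does not involve [x]: evaluation at
    [x = 0] is a ring morphism fixing [2t] and [e_q(t) + 1], and the quotient
    is unique. *)
Lemma genocchi_quotient_const : fps_map ev0 D = D.
Proof.
apply/esym/fps_div_unique; first exact: genocchi_denominator_neq0.
have ev0_E : fps_map ev0 (E + 1) = E + 1.
  apply: fpsP => n; rewrite -[LHS]/((fps_coef (E + 1) n).[0]%:P).
  by rewrite genocchi_denominator_coef hornerC.
rewrite -[X in _ * X]ev0_E -fps_mapM genocchi_divK //.
apply: fpsP => n; rewrite mulr_natl mulr2n.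
rewrite -[LHS]/((fps_coef (fps_t _ + fps_t _) n).[0]%:P) fps_coefD /=.
by rewrite -polyC_natr -polyCD hornerC.
Qed.

(** At [x = 0] the factor [e_q(xt)] becomes [1]. *)
Lemma genocchi_quotient_coef n :
  fps_coef D n = (genocchi_number q n / cq q n)%:P.
Proof.
have ev0_X : fps_map ev0 (eq_series q 'X) = 1.
  apply: fpsP => n'; rewrite fps_coef1 eq_seriesE //= /horner_eval.
  rewrite hornerZ hornerXn expr0n; case: n' => [|n'] /=.
    by rewrite invr1 mulr1.
  by rewrite mulr0.
rewrite -{1}genocchi_quotient_const -[fps_map _ D]mulr1.
rewrite -[X in _ * X]ev0_X -fps_mapM.
rewrite -[LHS]/((fps_coef (genocchi_series q) n).[0]%:P) genocchi_egf //=.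
by rewrite hornerZ mulrC.
Qed.

Lemma genocchi_number0 : genocchi_number q 0 = 0.
Proof.
have : (fps_coef (D * (E + 1)) 0).[0] = 0.
  by rewrite genocchi_divK // mulr_natl mulr2n fps_coefD /= addr0 horner0.
rewrite fps_coefM big_ord1.
rewrite genocchi_quotient_coef genocchi_denominator_coef /=.
rewrite !invr1 mulr1 hornerM !hornerC => /eqP.
by rewrite -mulr2n mulf_eq0 pnatr_eq0 orbF => /eqP.
Qed.

(** The top term of the convolution drops out, [E - 1] having no constant
    term. *)
Lemma weight_coef_sum j :
  fps_coef (D * (E - 1)) j =
    \sum_(m < j) (genocchi_number q m / (cq q m * cq q (j - m)))%:P.
Proof.
have coefE1 n : fps_coef (E - 1) n = ((cq q n)^-1 - (n == 0)%:R)%:P.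
  by rewrite fps_coefB eq_series1_coef fps_coef1 polyCB polyC_natr.
rewrite fps_coefM; under eq_bigr do
  rewrite coefE1 genocchi_quotient_coef -polyCM.
rewrite big_ord_recr /= subnn invr1 subrr mulr0 addr0.
apply: eq_bigr => m _.
by rewrite subn_eq0 leqNgt ltn_ord subr0 invfM mulrA.
Qed.

(** [D (E - 1) = D (E + 1) - 2 D], and [D (E + 1) = 2t] contributes only in
    degree 1. *)
Lemma weight_coef j :
  fps_coef (D * (E - 1)) j.+2 =
    (- 2 * (genocchi_number q j.+2 / cq q j.+2))%:P.
Proof.
have -> : D * (E - 1) = 2 * fps_t _ - D *+ 2.
  rewrite -[X in _ = X - _](genocchi_divK q_neq1).
  by rewrite mulrBr mulrDr mulr1 mulr2n opprD addrA addrK.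
rewrite fps_coefB [D *+ 2]mulr2n fps_coefD genocchi_quotient_coef.
rewrite mulr_natl mulr2n fps_coefD /= addr0 sub0r.
rewrite -polyCD -polyCN; congr _%:P; ring.
Qed.

Lemma weight_coef1 : fps_coef (D * (E - 1)) 1 = 0.
Proof. by rewrite weight_coef_sum big_ord1 genocchi_number0 mul0r. Qed.

Lemma genocchi_convolution n :
  genocchi q n = cq q n *:
    \sum_(k < n.+1) fps_coef (D * (E - 1)) (n - k).+1
                    * ((cq q k)^-1 *: bernoulli q k).
Proof.
congr (_ *: _); rewrite (fps_coef_convolution _ _ (D * (E - 1))
  (bernoulli_series q)); first by rewrite bernoulli_egf.
  rewrite /genocchi_series /bernoulli_series [D * (E - 1)]mulrC mulrACA.
  by rewrite [(E - 1) * _]mulrC bernoulli_divK.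
by rewrite weight_coef_sum big_ord0.
Qed.

Lemma genocchi_bernoulli_sum n :
  genocchi q n =
    (- 2 * (cq q n / cq q n.+1)) *:
      \sum_(k < n)
        (binomc q n.+1 k * genocchi_number q (n - k + 1)) *: bernoulli q k.
Proof.
rewrite genocchi_convolution big_ord_recr subnn weight_coef1 mul0r.
rewrite -[X in _ *: X]/(_ + _) addr0.
rewrite !scaler_sumr; apply: eq_bigr => k _.
have [j nk] : exists j, (n - k = j.+1)%N.
  by exists (n - k).-1; rewrite prednK // subn_gt0.
rewrite /binomc subSn 1?ltnW // nk addn1 weight_coef mul_polyC !scalerA.
congr (_ *: _); field.
by rewrite !cq_neq0.
Qed.

Lemma genocchi_bernoulli_double_sum n :
  genocchi q n =
    (cq q n / cq q n.+1) *:
      \sum_(k < n.+1) \sum_(m < (n - k).+1)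
        (trinomc q n.+1 k m * genocchi_number q m) *: bernoulli q k.
Proof.
rewrite genocchi_convolution !scaler_sumr; apply: eq_bigr => k _.
rewrite weight_coef_sum mulr_suml !scaler_sumr; apply: eq_bigr => m _.
rewrite /trinomc [(n.+1 - k)%N]subSn -1?ltnS // mul_polyC !scalerA.
congr (_ *: _); field.
by rewrite !cq_neq0.
Qed.

End GenocchiBernoulli.

Theorem theorem6p3 (R : realType) (q : R[i])
    (q_neq1 : q != 1)
    (q_gen : forall j : nat, (1 <= j)%N -> j%:R * q - (j%:R - 1) != 0)
    (n : nat) (n_ge1 : (1 <= n)%N) :
  genocchi q n =
    (- 2 * (cq q n / cq q n.+1)) *:
      \sum_(k < n)
        (binomc q n.+1 k * genocchi_number q (n - k + 1)) *: bernoulli q k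
  /\
  genocchi q n =
    (cq q n / cq q n.+1) *:
      \sum_(k < n.+1) \sum_(m < (n - k).+1)
        (trinomc q n.+1 k m * genocchi_number q m) *: bernoulli q k.
Proof.
split; first exact: genocchi_bernoulli_sum.
exact: genocchi_bernoulli_double_sum.
Qed.
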